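(* Let $X$ be a GNPC space. Then $X$ contains an open dense subset consisting of manifold points (of possibly different dimensions); that is, there is an open dense subset of $X$ each of whose points has a neighborhood homeomorphic to $\mathbb R^k$ for some $k\ge 0$ that may depend on the point.
   Context: A shortest path is an isometric embedding of a closed interval into a metric space; a geodesic space is a metric space in which any two points are joined by a shortest path. A complete geodesic space $(Y,d)$ is BNPC if for any two linearly (constant-speed) reparametrized shortest paths $\gamma,\eta:[0,1]\to Y$, the function $t\mapsto d(\gamma(t),\eta(t))$ is convex on $[0,1]$. A metric space is locally BNPC if every point has a neighborhood that is BNPC with respect to the ambient metric. A geodesic is a curve whose restriction to each sufficiently small subinterval is a shortest path. $X$ is locally geodesically complete if for every geodesic $\gamma:[a,b]\to X$ there exist $\varepsilon>0$ and a geodesic $\bar\gamma:[a-\varepsilon,b+\varepsilon]\to X$ with $\bar\gamma|_{[a,b]}=\gamma$. A GNPC space is a separable, locally compact, locally geodesically complete, locally BNPC metric space. *)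

(* Defs.v *)
From HB Require Import structures.
From mathcomp Require Import all_boot all_order all_algebra.
From mathcomp Require Import all_classical all_reals all_analysis.

Set Implicit Arguments.
Unset Strict Implicit.
Unset Printing Implicit Defensive.

Import Order.TTheory GRing.Theory Num.Theory.
Import numFieldNormedType.Exports.

Local Open Scope classical_set_scope.
Local Open Scope ring_scope.

(* A subset [A] of a metric space, seen as the type [set_type A], carries the
   restriction of the ambient metric. *)
Section subset_metric.
Context {R : realType} {X : metricType R} (A : set X).

Let sub_mdist (x y : set_type A) : R := mdist (set_val x) (set_val y).

Let sub_mdist_ge0 x y : 0 <= sub_mdist x y.
Proof. exact: mdist_ge0. Qed.

Let sub_mdist_positivity x y : sub_mdist x y = 0 -> x = y.
Proof. by move/mdist_positivity => xy; apply: val_inj. Qed.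

Let sub_ballEmdist (x : set_type A) d : ball x d = [set y | sub_mdist x y < d].
Proof. by rewrite -initial_ballE ballEmdist. Qed.

HB.instance Definition _ := PseudoMetric_isMetric.Build R (set_type A)
  sub_mdist_ge0 sub_mdist_positivity sub_ballEmdist.

End subset_metric.

(* Curves defined on [a, b] are represented by total functions on R whose
   values outside [a, b] are irrelevant. *)
Section curves.
Context {R : realType} {Y : metricType R}.
Implicit Types (c : R -> Y) (a b : R).

(* The degenerate case a = b is allowed, so that every point is joined to
   itself. *)
Definition shortest_path a b c : Prop :=
  a <= b /\ {in `[a, b] &, forall s t, mdist (c s) (c t) = `|s - t|}.

Definition linear_shortest_path c : Prop :=
  exists a b (p : R -> Y), shortest_path a b p /\
    {in `[0, 1], forall t, c t = p (a + t * (b - a))}.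

Definition geodesic a b c : Prop :=
  {within `[a, b], continuous c} /\
  exists2 delta : R, 0 < delta &
    forall s t, a <= s -> s <= t -> t <= b -> t - s <= delta ->
      shortest_path s t c.

End curves.

Definition complete_metric {R : realType} (Y : metricType R) : Prop :=
  forall u : nat -> Y, cauchy (u @ \oo) -> exists l : Y, u @ \oo --> l.

Definition geodesic_space {R : realType} (Y : metricType R) : Prop :=
  forall x y : Y, exists a b (c : R -> Y),
    [/\ shortest_path a b c, c a = x & c b = y].

Definition bnpc {R : realType} (Y : metricType R) : Prop :=
  [/\ complete_metric Y, geodesic_space Y &
    forall c e : R -> Y, linear_shortest_path c -> linear_shortest_path e ->
      convex_function (`[0, 1]%classic : set R^o)
        (fun t => mdist (c t) (e t))].

Definition locally_bnpc {R : realType} (X : metricType R) : Prop :=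
  forall x : X, exists2 N : set X, nbhs x N & bnpc (set_type N).

Definition locally_geodesically_complete {R : realType} (X : metricType R)
    : Prop :=
  forall a b (c : R -> X), a < b -> geodesic a b c ->
    exists2 eps : R, 0 < eps &
      exists2 cbar : R -> X, geodesic (a - eps) (b + eps) cbar &
        {in `[a, b], cbar =1 c}.

Definition separable (T : topologicalType) : Prop :=
  exists2 D : set T, countable D & dense D.

Definition gnpc {R : realType} (X : metricType R) : Prop :=
  [/\ separable X, locally_compact [set: X],
      locally_geodesically_complete X & locally_bnpc X].

Definition homeomorphic (T U : topologicalType) : Prop :=
  exists (f : T -> U) (g : U -> T),
    [/\ continuous f, continuous g, cancel f g & cancel g f].

(* ['rV[R]_k] has the product topology; for [k = 0] it is a one-point space. *)
Definition manifold_point {R : realType} {X : metricType R} (x : X) : Prop :=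
  exists (k : nat) (N : set X), nbhs x N /\ homeomorphic (set_type N) 'rV[R]_k.

(* Main.v *)
Require Import Defs.
From mathcomp Require Import all_boot all_order all_algebra.
From mathcomp Require Import all_classical all_reals all_analysis.
From mathcomp Require Import ring lra.

Set Implicit Arguments.
Unset Strict Implicit.
Unset Printing Implicit Defensive.

Import Order.TTheory GRing.Theory Num.Theory.
Import numFieldNormedType.Exports.

Local Open Scope classical_set_scope.
Local Open Scope ring_scope.

(** Why the theorem holds. Coordinates near a suitable point are given by
distance functions [f_i = d(P i, .)]; the question is to find finitely many of
them that together are injective and open on some nonempty open subset of any
prescribed open set.

Everything takes place in a small compact ball inside a BNPC neighborhood. There
the distance function is convex along shortest paths, and local geodesic
completeness lets every shortest path be extended up to a fixed length
([gnpc_normal_ball]).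

Openness comes from strainers. Points [P 0], ..., [P (k-1)] strain an open set
[W] when, for [i < j], the function [f_i] is almost constant along shortest
paths to [P j] inside [W]. From a point of [W] one can move towards [P j] or
away from it; this changes [f_j] at unit speed in either direction, leaves the
earlier functions almost unchanged, and changes the later ones at most at unit
speed. With rapidly decreasing weights, a minimiser of the weighted distance
from [(f_i)] to a prescribed nearby value must therefore attain that value
([strainer_surj]).

The number [k] is bounded: moving from a point of [W] by a distance [t] towards
the various [P j] gives [k] points at mutual distance at least [t / 2], and
extending these paths to a fixed length spreads them apart proportionally, by
convexity, inside a compact ball ([strainer_bound]).

Finally, a strainer that is not injective on any nonempty open subset of [W]
can be lengthened ([strainer_step]). Convex functions on an interval are
differentiable outside a countable set; the analogue needed here is that each
[f_i] is almost differentiable along all shortest paths through the points of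
some nonempty open set, uniformly at some scale ([generic_smooth]). If [y] and
[z] are two nearby points of that open set at which all the [f_i] agree, then
[f_i] does not increase from [y] towards [z], by convexity, and increases at
most slowly on any extension beyond [y], by smoothness. These estimates persist
approximately near [y], and together they bound the variation of [f_i] from both
sides. So [z] is a further straining point for a neighborhood of [y]. A strainer
that cannot be lengthened thus gives coordinates on an open set
([exists_coordinates]), and the coordinates are a homeomorphism onto an open
subset of a Euclidean space ([coordinates_manifold_point]). *)

(** * Convexity in BNPC spaces *)

Section ratios.
Context {R : realType} {Y : metricType R}.
Implicit Types (y a w : Y) (t : R).

(** Points dividing a shortest path in a given ratio are described by distances
alone, so that no parametrization of the path has to be carried along. The
degenerate case [y = a] allows constant paths. *)
Definition at_ratio y a t w : Prop :=
  mdist y w = t * mdist y a /\ mdist w a = (1 - t) * mdist y a.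

Lemma at_ratio_const y t : at_ratio y y t y.
Proof. by rewrite /at_ratio mdistxx !mulr0. Qed.

Lemma at_ratio_sym y a t w : at_ratio y a t w -> at_ratio a y (1 - t) w.
Proof.
move=> [yw wa]; split; first by rewrite metric_sym wa (metric_sym a).
by rewrite metric_sym yw (metric_sym a) subKr.
Qed.

Lemma path_at_ratio (D t : R) (c : R -> Y) : shortest_path 0 D c -> 0 <= t <= 1 ->
  at_ratio (c 0) (c D) t (c (t * D)).
Proof.
move=> [D0 cE] /andP[t0 t1].
have i0 : 0 \in `[0, D] by rewrite in_itv/= lexx.
have iD : D \in `[0, D] by rewrite in_itv/= lexx D0.
have it : t * D \in `[0, D] by rewrite in_itv/= mulr_ge0//= ler_piMl.
rewrite /at_ratio !cE// !sub0r !normrN (ger0_norm D0) ger0_norm ?mulr_ge0//.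
split=> //; rewrite distrC ger0_norm ?subr_ge0 ?ler_piMl//.
by rewrite mulrBl mul1r.
Qed.

Lemma geodesic_space_path y a : geodesic_space Y ->
  exists c : R -> Y, [/\ shortest_path 0 (mdist y a) c, c 0 = y & c (mdist y a) = a].
Proof.
move=> /(_ y a)[s [e [c [[se cE] cs ce]]]].
have yaE : mdist y a = e - s.
  rewrite -cs -ce cE ?in_itv/= ?lexx ?se//.
  by rewrite distrC ger0_norm// subr_ge0.
exists (fun x => c (s + x)); rewrite addr0; split=> //.
- split=> [|u v]; first exact: mdist_ge0.
  rewrite !in_itv/= yaE => /andP[u0 ue] /andP[v0 ve].
  rewrite cE ?in_itv/=; [|lra|lra].
  by congr `| _ |; ring.
- by rewrite yaE addrC subrK.
Qed.

(** Concatenating shortest paths from [y] to [w] and from [w] to [a] gives a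
shortest path as soon as the lengths add up. *)
Lemma at_ratio_linear y a t w : geodesic_space Y -> 0 <= t <= 1 -> at_ratio y a t w ->
  exists e : R -> Y, [/\ linear_shortest_path e, e 0 = y, e t = w & e 1 = a].
Proof.
move=> gY /andP[t0 t1] [yw wa].
have [c1 [[_ c1E] c10 c1D]] := geodesic_space_path y w gY.
have [c2 [[_ c2E] c20 c2D]] := geodesic_space_path w a gY.
set D := mdist y a in yw wa *; set h := mdist y w in yw c1E c1D.
have D0 : 0 <= D by exact: mdist_ge0.
have h0 : 0 <= h by exact: mdist_ge0.
have hD : h <= D by rewrite yw ler_piMl.
have waE : mdist w a = D - h by rewrite wa yw; ring.
rewrite waE in c2E c2D.
pose p x := if x <= h then c1 x else c2 (x - h).
have pD : p D = a.
  rewrite /p; case: ifPn => [Dh|_//].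
  have E : D = h by apply/le_anti/andP.
  rewrite E c1D; apply: mdist_positivity; rewrite waE; lra.
have pE1 u : u <= h -> p u = c1 u by rewrite /p => ->.
have pE2 u : h < u -> p u = c2 (u - h) by rewrite /p ltNge => /negbTE ->.
have ple u v : 0 <= u -> u <= v -> v <= D -> mdist (p u) (p v) = v - u.
  move=> u0 uv vD; have [vh|hv] := leP v h.
    rewrite !pE1//; last lra.
    rewrite c1E ?in_itv/=; [|lra|lra].
    rewrite distrC ger0_norm//; lra.
  have [uh|hu] := leP u h; last first.
    rewrite !pE2// c2E ?in_itv/=; [|lra|lra].
    rewrite distrC ger0_norm; lra.
  rewrite (pE1 u)// (pE2 v)//.
  have e1 : mdist (c1 u) w = h - u.
    rewrite -c1D c1E ?in_itv/=; [|lra|lra].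
    rewrite distrC ger0_norm; lra.
  have e2 : mdist w (c2 (v - h)) = v - h.
    rewrite -c20 c2E ?in_itv/=; [|lra|lra].
    rewrite distrC ger0_norm; lra.
  have e3 : mdist y (c1 u) = u.
    rewrite -c10 c1E ?in_itv/=; [|lra|lra].
    rewrite distrC ger0_norm; lra.
  have e4 : mdist (c2 (v - h)) a = D - v.
    rewrite -c2D c2E ?in_itv/=; [|lra|lra].
    rewrite distrC ger0_norm; lra.
  have := metric_triangle (c1 u) w (c2 (v - h)).
  have := metric_triangle y (c1 u) a; rewrite -/D.
  have := metric_triangle (c1 u) (c2 (v - h)) a.
  by move=> A1 A2 A3; apply/le_anti/andP; split; lra.
exists (fun x => p (x * D)); split.
- exists 0, D, p; split; last by move=> x _; rewrite add0r subr0.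
  split=> // u v; rewrite !in_itv/= => /andP[u0 uD] /andP[v0 vD].
  have [uv|vu] := leP u v.
    by rewrite ple// distrC ger0_norm// subr_ge0.
  by rewrite metric_sym ple ?(ltW vu)// ger0_norm// subr_ge0 ltW.
- by rewrite mul0r pE1.
- by rewrite -yw pE1.
- by rewrite mul1r.
Qed.

(** Both points lie on linear paths, where the convexity of the distance
between the paths is given. *)
Lemma bnpc_at_ratio y a w y' a' w' t : bnpc Y -> 0 <= t <= 1 ->
  at_ratio y a t w -> at_ratio y' a' t w' ->
  mdist w w' <= (1 - t) * mdist y y' + t * mdist a a'.
Proof.
move=> [_ gY cY] /andP[t0 t1] f f'.
have [|e [le e0 et e1]] := at_ratio_linear gY _ f; first by rewrite t0.
have [|e' [le' e'0 e't e'1]] := at_ratio_linear gY _ f'; first by rewrite t0.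
have i01 x : 0 <= x <= 1 -> x \in (`[0, 1]%classic : set R^o).
  by move=> xi; rewrite inE/= in_itv.
have cE : conv (Itv01 t0 t1) (1 : convex_lmodType R^o) 0 = t.
  change (t * 1 + (1 - t) * 0 = t); ring.
have := cY e e' le le' (Itv01 t0 t1) 1 0.
rewrite !convRE/= /unstable.onem cE.
rewrite et e't e1 e'1 e0 e'0 addrC; apply; apply: i01; lra.
Qed.

End ratios.

Section convex_region.
Context {R : realType} {X : metricType R}.
Implicit Types (N : set X) (p y a w : X) (s t : R).

(** The consequences of the BNPC condition on a subset [N], expressed by points
of the ambient space, so that no coercion from the subtype remains. *)
Record convex_region N : Prop := ConvexRegion {
  region_path : forall y a, N y -> N a -> exists c : R -> X,
    [/\ shortest_path 0 (mdist y a) c, c 0 = y, c (mdist y a) = a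
      & forall t, 0 <= t <= mdist y a -> N (c t)];
  region_at_ratio : forall y a w y' a' w' t,
    [/\ N y, N a & N w] -> [/\ N y', N a' & N w'] -> 0 <= t <= 1 ->
    at_ratio y a t w -> at_ratio y' a' t w' ->
    mdist w w' <= (1 - t) * mdist y y' + t * mdist a a' }.

Lemma bnpc_region N : bnpc (set_type N) -> convex_region N.
Proof.
move=> bN; pose pt z (Nz : N z) : set_type N := SigSub (mem_set Nz).
split=> [y a Ny Na|y a w y' a' w' t [Ny Na Nw] [Ny' Na' Nw'] t01 f f'].
  have [_ gN _] := bN.
  have [c [cE c0 cD]] := geodesic_space_path (pt y Ny) (pt a Na) gN.
  exists (fun t => set_val (c t)); split=> //.
  - exact: (congr1 set_val c0).
  - exact: (congr1 set_val cD).
  - by move=> t _; exact: set_valP.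
exact: (@bnpc_at_ratio R (set_type N) (pt y Ny) (pt a Na) (pt w Nw)
  (pt y' Ny') (pt a' Na') (pt w' Nw') t bN t01 f f').
Qed.

Definition btw y w a : Prop := mdist y a = mdist y w + mdist w a.

Lemma btw_sym y w a : btw y w a -> btw a w y.
Proof.
by rewrite /btw (metric_sym a y) (metric_sym a) (metric_sym w y) addrC.
Qed.

Lemma btw_at_ratio y w a t : btw y w a -> mdist y w = t * mdist y a ->
  at_ratio y a t w.
Proof. by rewrite /btw /at_ratio => + E; rewrite E => H; split=> //; lra. Qed.

Lemma path_dist D (c : R -> X) s t : shortest_path 0 D c ->
  0 <= s -> s <= t -> t <= D -> mdist (c s) (c t) = t - s.
Proof.
move=> [_ cE] s0 st tD; rewrite cE ?in_itv/=; [|lra..].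
by rewrite distrC ger0_norm; lra.
Qed.

Lemma path_btw D (c : R -> X) s t u : shortest_path 0 D c ->
  0 <= s -> s <= t -> t <= u -> u <= D -> btw (c s) (c t) (c u).
Proof.
move=> cE s0 st tu uD.
by rewrite /btw !(path_dist cE); lra.
Qed.

Section in_region.
Context {N : set X} (cN : convex_region N).

Lemma region_point y a s : N y -> N a -> 0 <= s <= mdist y a ->
  exists w, [/\ N w, mdist y w = s & btw y w a].
Proof.
move=> Ny Na /andP[s0 sD].
have [c [cE c0 cD cN']] := region_path cN Ny Na.
exists (c s); split; first by apply: cN'; rewrite s0.
- by rewrite -[in LHS]c0 (path_dist cE)// subr0.
- by have := path_btw cE (lexx 0) s0 sD (lexx _); rewrite c0 cD.
Qed.

Lemma region_fellow y a w y' a' w' s S : [/\ N y, N a & N w] ->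
  [/\ N y', N a' & N w'] -> 0 <= s <= S -> 0 < S ->
  btw y w a -> btw y' w' a' -> mdist y a = S -> mdist y' a' = S ->
  mdist y w = s -> mdist y' w' = s ->
  mdist w w' <= (1 - s / S) * mdist y y' + s / S * mdist a a'.
Proof.
move=> ? ? /andP[s0 sS] S0 b b' yaS y'a'S yws y'w's.
apply: (region_at_ratio cN) => //.
- by rewrite divr_ge0//= ?ler_pdivrMr ?mul1r// ltW.
- by apply: btw_at_ratio => //; rewrite yaS yws divfK// gt_eqF.
- by apply: btw_at_ratio => //; rewrite y'a'S y'w's divfK// gt_eqF.
Qed.

(** Convexity of the distance to [p] along a shortest path, multiplied by the
length of the path so that the path may be constant. *)
Lemma region_dist_convex p y w a : [/\ N p, N y, N w & N a] -> btw y w a ->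
  mdist y a * mdist p w <= mdist w a * mdist p y + mdist y w * mdist p a.
Proof.
move=> [Np Ny Nw Na] b.
have yw0 := mdist_ge0 y w; have wa0 := mdist_ge0 w a.
have [D0|D0] := leP (mdist y a) 0.
  have := mdist_ge0 p w; have := mdist_ge0 p y; have := mdist_ge0 p a.
  have -> : mdist y a = 0 by apply/le_anti; rewrite D0 mdist_ge0.
  by rewrite mul0r => *; rewrite addr_ge0// mulr_ge0.
set D := mdist y a in b D0 *.
have bD : mdist y w <= D by move: b; rewrite /btw -/D; lra.
have := @region_at_ratio _ cN p p p y a w (mdist y w / D).
move=> /(_ _ _ _ (at_ratio_const _ _)) H.
have {H} : mdist p w <= (1 - mdist y w / D) * mdist p y + mdist y w / D * mdist p a.
  apply: H => //; last by apply: btw_at_ratio => //; rewrite divfK// gt_eqF.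
  by rewrite divr_ge0//= ?ler_pdivrMr ?mul1r// ltW.
rewrite -(ler_pM2l D0) => /le_trans; apply.
rewrite le_eqVlt; apply/orP; left; apply/eqP.
have -> : mdist w a = D - mdist y w by move: b; rewrite /btw -/D; lra.
by field; rewrite gt_eqF.
Qed.

End in_region.
End convex_region.

(** * Metric preliminaries *)

Section metric_facts.
Context {R : realType} {X : metricType R}.
Implicit Types (p q x y : X) (e : R) (A K U : set X).

Lemma nbhs_mdist x A : nbhs x A <->
  exists2 e, 0 < e & forall y, mdist x y < e -> A y.
Proof. by split=> [/metricType_numDomainType.nbhs_mdistP|H];
  [|apply/metricType_numDomainType.nbhs_mdistP]. Qed.

Lemma open_mdist A x : open A -> A x ->
  exists2 e, 0 < e & forall y, mdist x y < e -> A y.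
Proof. by rewrite openE => /[apply] /nbhs_mdist. Qed.

Lemma mdist_open x e : open [set y | mdist x y < e].
Proof.
rewrite openE => y /= xy; apply/nbhs_mdist; exists (e - mdist x y); first lra.
by move=> z yz /=; have := metric_triangle x y z; lra.
Qed.

Lemma mdist_lipschitz p x y : `|mdist p x - mdist p y| <= mdist x y.
Proof.
have := metric_triangle p x y; have := metric_triangle p y x.
by rewrite (metric_sym y x) ler_norml => *; apply/andP; split; lra.
Qed.

Lemma mdist_continuous p : continuous (mdist p : X -> R).
Proof.
move=> x; apply/cvgrPdist_lt => e e0; apply/nbhs_mdist; exists e => // y xy.
by apply: le_lt_trans xy; exact: mdist_lipschitz.
Qed.

Lemma mdist_closed x e : closed [set y | mdist x y <= e].
Proof.
apply: (@preimage_closed _ _ (mdist x : X -> R) [set z | z <= e]).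
  by move=> y _; exact: mdist_continuous.
exact: closed_le.
Qed.

(** Compactness is applied as a near covering, along the filter of all finite
sequences ordered by inclusion. *)
Lemma compact_net K e : compact K -> 0 < e ->
  exists s : seq X, forall x, K x -> exists2 q, q \in s & mdist q x < e.
Proof.
move=> /compact_near_coveringP cK e0.
pose B (s : seq X) := [set s' : seq X | {subset s <= s'}].
pose F := filter_from [set: seq X] B.
have FF : Filter F.
  apply: filter_fromT_filter; first by exists [::].
  move=> s t; exists (s ++ t) => u stu; split=> z zs; apply: stu.
    by rewrite mem_cat zs.
  by rewrite mem_cat zs orbT.
have [|s _ sK] := cK _ F (fun s x => exists2 q, q \in s & mdist q x < e).
  move=> x Kx; exists ([set y | mdist x y < e], B [:: x]).
    split; last by exists [:: x].
    by apply/nbhs_mdist; exists e.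
  move=> [y s] [/= xy xs]; exists x => //.
  by apply: xs; rewrite inE.
by exists s => x Kx; exact: (sK s).
Qed.

End metric_facts.

Section shortest_path.
Context {R : realType} {X : metricType R}.

Lemma shortest_geodesic a b (c : R -> X) : shortest_path a b c -> geodesic a b c.
Proof.
move=> [ab cE]; split.
  apply/subspace_continuousP => x xab.
  apply/metricType_numDomainType.cvgrPdist_lt => e e0.
  rewrite near_withinE; apply/nbhs_ballP; exists e => // y xy yab.
  by rewrite cE.
exists 1 => // s t as_ st tb _; split=> // u v.
by rewrite !in_itv/= => /andP[su ut] /andP[sv vt]; apply: cE; rewrite in_itv/=; lra.
Qed.

End shortest_path.

(** * Extension of shortest paths *)

Section extension.
Context {R : realType} {X : metricType R}.
Implicit Types (N : set X) (o y w : X) (r l : R).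

(** The factors leave room: points within [4 * r] of [o] are joined and extended,
by at most [4 * r], without leaving the compact ball of radius [9 * r]. *)
Record normal_ball N o r : Prop := NormalBall {
  nb_region : convex_region N;
  nb_gt0 : 0 < r;
  nb_sub : forall x, mdist o x <= 9 * r -> N x;
  nb_compact : compact [set x | mdist o x <= 9 * r];
  nb_extend : forall y w l, mdist o y <= 4 * r -> mdist o w <= 4 * r ->
    y <> w -> 0 <= l <= 4 * r ->
    exists w', mdist w w' = l /\ btw y w w' }.

(** A local geodesic is shortest. Extend a shortest path from [y] to [w] by a
short length [h] to [w'], so that it stays shortest on the last [2 * h]. The
point [m] at distance [h] before [w] is compared with the point [s] dividing the
shortest path from [w'] to [y] in the same ratio: by convexity
[d(m, s) <= (1 - h / L) * h], and [d(m, w') = 2 * h] then forces [d(y, w')] to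
be at least [L + h]. *)
Lemma local_extension N y w e : locally_geodesically_complete X ->
  convex_region N -> N y -> N w -> y <> w -> 0 < e ->
  (forall z, mdist w z < e -> N z) ->
  exists w', [/\ 0 < mdist w w', mdist w w' < e & btw y w w'].
Proof.
move=> gX cN Ny Nw yw e0 eN.
have [c [cE c0 cD cN']] := region_path cN Ny Nw.
set L := mdist y w in cE cD cN'.
have L0 : 0 < L by rewrite /L mdist_gt0; apply/eqP.
have [eps eps0 [k [_ [delta delta0 kS]] kc]] := gX _ _ _ L0 (shortest_geodesic cE).
pose h := Num.min (Num.min (delta / 2) eps) (Num.min L (e / 2)).
have h0 : 0 < h by rewrite /h !lt_min; apply/and3P; split; lra.
have [hd heps hL he] : [/\ h <= delta / 2, h <= eps, h <= L & h <= e / 2].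
  by rewrite /h; split; rewrite !ge_min lexx ?orbT.
have kE t : 0 <= t <= L -> k t = c t by move=> tL; apply: kc; rewrite in_itv.
have [_ kS'] := kS (L - h) (L + h) ltac:(lra) ltac:(lra) ltac:(lra) ltac:(lra).
pose w' := k (L + h); pose m := c (L - h).
have kL : k L = w by rewrite kE ?cD//; lra.
have km : k (L - h) = m by rewrite kE//; lra.
have mw' : mdist m w' = 2 * h.
  rewrite -km /w' kS' ?in_itv/=; [|lra|lra].
  by rewrite distrC ger0_norm; lra.
have ww' : mdist w w' = h.
  rewrite -kL /w' kS' ?in_itv/=; [|lra|lra].
  by rewrite distrC ger0_norm; lra.
have Nw' : N w' by apply: eN; rewrite ww'; lra.
have Nm : N m by apply: cN'; lra.
have t01 : 0 <= h / L <= 1 by rewrite divr_ge0 ?ler_pdivrMr ?mul1r//; lra.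
have fm : at_ratio w y (h / L) m.
  have Lh : h / L * L = h by rewrite divfK// gt_eqF.
  have := path_at_ratio cE (t := 1 - h / L) ltac:(lra).
  rewrite c0 cD mulrBl Lh mul1r -/m => /at_ratio_sym.
  by rewrite opprB addrC subrK.
have [s [Ns ws bs]] : exists s, [/\ N s, mdist w' s = h / L * mdist w' y & btw w' s y].
  apply: (region_point cN) => //.
  by rewrite mulr_ge0 ?mdist_ge0 ?ler_piMl ?mdist_ge0//; lra.
have := region_at_ratio cN (And3 Nw Ny Nm) (And3 Nw' Ny Ns) t01 fm (btw_at_ratio bs ws).
rewrite mdistxx mulr0 addr0 ww' => ms.
have wsy : 2 * h <= mdist m s + mdist w' s.
  by rewrite -mw' (metric_sym w'); exact: metric_triangle.
have D : L + h <= mdist y w'.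
  rewrite -(ler_pM2l (_ : 0 < h / L)) ?divr_gt0// (metric_sym y).
  have -> : h / L * (L + h) = h + h / L * h by field; rewrite gt_eqF.
  rewrite -ws; lra.
exists w'; rewrite ww'; split; [exact: h0|lra|].
rewrite /btw ww' -/L; apply/le_anti; rewrite D andbT.
by rewrite /L -ww'; exact: metric_triangle.
Qed.

(** The lengths of the extensions inside a compact ball have a maximum, and
local extension shows that only the prescribed length can be maximal. *)
Lemma region_normal_ball N o r : locally_geodesically_complete X ->
  convex_region N -> 0 < r -> (forall x, mdist o x <= 9 * r -> N x) ->
  compact [set x | mdist o x <= 9 * r] -> normal_ball N o r.
Proof.
move=> gX cN r0 sN cK; split=> // y w l oy ow yw /andP[l0 lr].
set K := [set x | _] in cK.
pose g z : R := mdist y z - mdist w z.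
have gc : continuous g.
  by move=> z; apply: cvgB; exact: mdist_continuous.
pose E := K `&` ([set z | mdist y w <= g z] `&` [set z | mdist w z <= l]).
have cE : compact E.
  apply: subclosed_compact cK _; last by move=> z [].
  apply: closedI; first exact: mdist_closed.
  apply: closedI; last exact: mdist_closed.
  apply: (@preimage_closed _ _ g [set z | mdist y w <= z]); last exact: closed_ge.
  by move=> z _; exact: gc.
have Ew : E w by rewrite /E /K /g /=; split; [|rewrite mdistxx subr0 lexx]; lra.
have [] := @compact_EVT_max _ _ (mdist w : X -> R) E (ex_intro _ w Ew) cE.
  by apply: continuous_subspaceT; exact: mdist_continuous.
move=> w1; rewrite inE => -[Kw1 [/= gw1 wl]] w1max.
have [wl'|lw] := ltP (mdist w w1) l; last first.
  exists w1; split; first by apply/le_anti/andP.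
  by rewrite /btw; have := metric_triangle y w w1; move: gw1; rewrite /g; lra.
have yw1 : y <> w1.
  move=> yw1; move: gw1; rewrite /g -yw1 mdistxx.
  have : 0 < mdist y w by rewrite mdist_gt0; apply/eqP.
  by have := mdist_ge0 w y; lra.
have ow1 : mdist o w1 <= 8 * r by have := metric_triangle o w w1; lra.
have [|||||w2 [w12 w12' b]] := @local_extension N y w1 (Num.min r (l - mdist w w1)) gX cN.
- by apply: sN; lra.
- exact: sN.
- exact: yw1.
- by rewrite lt_min; lra.
- move=> z; rewrite lt_min => /andP[zr _]; apply: sN.
  by have := metric_triangle o w1 z; lra.
exfalso; move: w12'; rewrite lt_min => /andP[w2r w2l].
have ww2 := metric_triangle w w1 w2.
have yw2 := metric_triangle y w w2.
have : mdist w w2 <= mdist w w1.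
  apply: w1max; rewrite inE /E /K /g /=; split.
    by have := metric_triangle o w1 w2; lra.
  by move: b gw1; rewrite /btw /g => b gw1; split; lra.
by move: b gw1; rewrite /btw /g; lra.
Qed.

Lemma gnpc_normal_ball (V : set X) o : gnpc X -> open V -> V o ->
  exists N r, normal_ball N o r /\ forall x, mdist o x < r -> V x.
Proof.
move=> [_ lX gX bX] oV Vo.
have [e1 e10 e1V] := open_mdist oV Vo.
have [N /nbhs_mdist[e2 e20 e2N] /bnpc_region cN] := bX o.
have := lX o I; rewrite withinET.
move=> [C /nbhs_mdist[e3 e30 e3C] [cC clC]].
pose r := Num.min e1 (Num.min e2 e3) / 10.
have r0 : 0 < r by rewrite divr_gt0// !lt_min; apply/and3P; split; lra.
have [r1 r2 r3] : [/\ 10 * r <= e1, 10 * r <= e2 & 10 * r <= e3].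
  have -> : 10 * r = Num.min e1 (Num.min e2 e3) by rewrite /r; lra.
  by split; rewrite !ge_min lexx ?orbT.
exists N, r; split; last by move=> x xr; apply: e1V; lra.
apply: region_normal_ball => //; first by move=> x xr; apply: e2N; lra.
apply: subclosed_compact cC _; first exact: mdist_closed.
by move=> x /= xr; apply: e3C; lra.
Qed.

End extension.

(** * Strainers *)

Section betweenness.
Context {R : realType} {X : metricType R}.
Implicit Types (x y a b w : X).

Lemma btw_trans x a b w : btw x a w -> btw a b w -> btw x a b /\ btw x b w.
Proof.
rewrite /btw => xaw abw; have := metric_triangle x a b.
by have := metric_triangle x b w; split; lra.
Qed.

(** Shortest paths are unique: two points dividing the same pair in the same
ratio are at distance zero by convexity. *)
Lemma region_unique N y a (c : R -> X) w : convex_region N -> N y -> N a ->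
  shortest_path 0 (mdist y a) c -> c 0 = y -> c (mdist y a) = a ->
  N w -> N (c (mdist y w)) -> btw y w a -> c (mdist y w) = w.
Proof.
move=> cN Ny Na cE c0 cD Nw Ncw b; apply: mdist_positivity.
have yw0 := mdist_ge0 y w; have wa0 := mdist_ge0 w a.
have [D0|D0] := leP (mdist y a) 0.
  have -> : mdist y w = 0 by move: b D0; rewrite /btw; lra.
  by rewrite c0; move: b D0; rewrite /btw; lra.
have ywD : mdist y w <= mdist y a by rewrite b; lra.
have b' : btw y (c (mdist y w)) a.
  by have := path_btw cE (lexx 0) yw0 ywD (lexx _); rewrite c0 cD.
have e' : mdist y (c (mdist y w)) = mdist y w.
  by rewrite -{1}c0 (path_dist cE)// subr0.
apply/le_anti; rewrite mdist_ge0 andbT.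
have := region_fellow cN (And3 Ny Na Ncw) (And3 Ny Na Nw) _ D0 b' b erefl erefl e' erefl.
by rewrite !mdistxx !mulr0 addr0; apply; lra.
Qed.

End betweenness.

Section strainers.
Context {R : realType} {X : metricType R} {N : set X} (o : X) (r : R).
Context (nb : normal_ball N o r).
Implicit Types (p x y w : X) (e s t : R) (U V W : set X).

Let cN : convex_region N. Proof. exact: (nb_region nb). Qed.
Let sN x : mdist o x <= 9 * r -> N x. Proof. exact: (nb_sub nb). Qed.

(** The condition [strainer_flat] is triangular: it restricts the functions of
smaller index only. Because of the absolute value it bounds the change of the
distance to [P i] both towards [P j] and away from it. *)
Record strainer W k (P : nat -> X) e : Prop := Strainer {
  strainer_open : open W;
  strainer_sub : forall x, W x -> mdist o x < r;
  strainer_pts : forall i, (i < k)%N -> mdist o (P i) < r /\ ~ W (P i);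
  strainer_flat : forall i j, (i < j)%N -> (j < k)%N ->
    forall y w, W y -> W w -> btw y w (P j) ->
    `|mdist (P i) y - mdist (P i) w| <= e * mdist y w }.

(** Let [a j] be the point at a small distance [t] from [y] towards [P j]. For
[i < j] the distance to [P i] falls by [t] at [a i] but hardly changes at
[a j], so that [a i] and [a j] are at distance at least [t / 2]. Extending both
paths from length [t] to length [r] gives points at distance at least [r / 2],
of which a compact ball contains only boundedly many. *)
Lemma strainer_bound : exists M : nat, forall W k P e,
  strainer W k P e -> W !=set0 -> e <= 1 / 2 -> (k <= M)%N.
Proof.
have r0 := nb_gt0 nb.
have [L LK] := compact_net (nb_compact nb) (divr_gt0 r0 (ltr0n _ 4)).
exists (size L) => W k P e S [y Wy] e2.
have [t2 t20 tW] := open_mdist (strainer_open S) Wy.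
pose t := Num.min (t2 / 2) r.
have t0 : 0 < t by rewrite lt_min; lra.
have [tt2 tr] : t <= t2 / 2 /\ t <= r by rewrite /t !ge_min !lexx orbT.
have oy := strainer_sub S Wy.
have /choice[a aP] (j : 'I_k) : exists a, [/\ mdist y a.1 = t, btw y a.1 (P j),
    mdist y a.2 = r, btw y a.1 a.2 & exists2 q, q \in L & mdist q a.2 < r / 4].
  have [oP WP] := strainer_pts S (ltn_ord j).
  have tP : t2 <= mdist y (P j) by rewrite leNgt; apply/negP => /tW.
  have [|||w [Nw yw b]] := region_point cN (y := y) (a := P j) (s := t).
  - by apply: sN; lra.
  - by apply: sN; lra.
  - by lra.
  have [||||A [wA yA]] := nb_extend nb (y := y) (w := w) (l := r - t).
  - lra.
  - by have := metric_triangle o y w; lra.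
  - by move=> ywE; move: t0; rewrite -yw ywE mdistxx ltxx.
  - lra.
  exists (w, A); split=> //=; first by rewrite yA wA yw; lra.
  by apply: LK => /=; have := metric_triangle o y A; rewrite yA wA yw; lra.
have aW j : W (a j).1 by have [ya _ _ _ _] := aP j; apply: tW; lra.
have oA j : mdist o (a j).2 <= 2 * r.
  by have [_ _ yA _ _] := aP j; have := metric_triangle o y (a j).2; lra.
have /choice[q qP] (j : 'I_k) : exists q, q \in L /\ mdist q (a j).2 < r / 4.
  by have [_ _ _ _ [q qL qa]] := aP j; exists q.
have sep (i j : 'I_k) : (i < j)%N -> r / 2 <= mdist (a i).2 (a j).2.
  move=> ij; have [yai bi yAi bAi _] := aP i; have [yaj bj yAj bAj _] := aP j.
  have := strainer_flat S ij (ltn_ord j) Wy (aW j) bj.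
  rewrite yaj ler_norml => /andP[_ fl].
  have et : e * t <= 1 / 2 * t by rewrite ler_wpM2r// ltW.
  have tri := metric_triangle (P i) (a i).1 (a j).1.
  move: bi; rewrite /btw yai (metric_sym _ (P i)) (metric_sym _ (P i)) => bi.
  have Na j' : N (a j').1.
    by apply: sN; have := strainer_sub S (aW j'); lra.
  have NA j' : N (a j').2 by apply: sN; have := oA j'; lra.
  have Ny : N y by apply: sN; lra.
  have := region_fellow cN (And3 Ny (NA i) (Na i)) (And3 Ny (NA j) (Na j))
    _ r0 bAi bAj yAi yAj yai yaj.
  rewrite mdistxx mulr0 add0r => /(_ _) fel.
  have {}fel : mdist (a i).1 (a j).1 <= t / r * mdist (a i).2 (a j).2.
    by apply: fel; lra.
  have : t * (r / 2) <= t * mdist (a i).2 (a j).2.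
    have -> : t * mdist (a i).2 (a j).2 = r * (t / r * mdist (a i).2 (a j).2).
      by field; rewrite gt_eqF.
    have -> : t * (r / 2) = r * (t / 2) by ring.
    by rewrite ler_pM2l//; lra.
  by rewrite ler_pM2l.
have qinj : injective q.
  move=> i j qij; apply: contrapT => ij.
  wlog ltij : i j qij ij / (i < j)%N.
    move=> H; have /orP[] : ((i < j) || (j < i))%N; last 2 first.
    - exact: H.
    - by apply: H => // /esym.
    by rewrite -neq_ltn; apply/eqP => ijn; apply: ij; apply: val_inj.
  have := sep _ _ ltij; have [_ qi] := qP i; have [_] := qP j; rewrite -qij => qj.
  have := metric_triangle (a i).2 (q i) (a j).2.
  by rewrite (metric_sym _ (q i)); lra.
have := @uniq_leq_size _ [seq q j | j <- enum 'I_k] L.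
rewrite (map_inj_uniq qinj) enum_uniq size_map size_enum_ord; apply=> //.
by move=> _ /mapP[j _ ->]; have [] := qP j.
Qed.

(** To lower the distance to [P i] one moves towards [P i], to raise it one
extends the shortest path from [P i] beyond the current point. *)
Lemma strainer_move W k P e w0 i (v h : R) : strainer W k P e -> W w0 ->
  (i < k)%N -> mdist (P i) w0 != v -> 0 < h ->
  exists w, [/\ 0 < mdist w0 w, mdist w0 w < h,
    `|mdist (P i) w - v| = `|mdist (P i) w0 - v| - mdist w0 w
    & btw w0 w (P i) \/ btw w w0 (P i)].
Proof.
move=> S Ww0 ik fv h0; have r0 := nb_gt0 nb; have [oP WP] := strainer_pts S ik.
have ow0 := strainer_sub S Ww0.
have wP : P i <> w0 by move=> E; apply: WP; rewrite E.
have dP : 0 < mdist (P i) w0 by rewrite mdist_gt0; apply/eqP.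
have n0 : 0 < `|mdist (P i) w0 - v| by rewrite normr_gt0 subr_eq0.
pose t := Num.min (Num.min (h / 2) r) (Num.min (mdist (P i) w0) `|mdist (P i) w0 - v|).
have t0 : 0 < t by rewrite !lt_min n0 dP r0; lra.
have [th tr tP tn] : [/\ t <= h / 2, t <= r, t <= mdist (P i) w0 & t <= `|mdist (P i) w0 - v|].
  by rewrite /t !ge_min !lexx !orbT.
have [vf|fv'] := ltP v (mdist (P i) w0).
  rewrite gtr0_norm ?subr_gt0// in tn *.
  have [|||w [Nw ww b]] := region_point cN (y := w0) (a := P i) (s := t).
  - by apply: sN; lra.
  - by apply: sN; lra.
  - by rewrite metric_sym; lra.
  exists w; rewrite ww; split=> //; [lra| |by left].
  move: b; rewrite /btw ww (metric_sym w0) (metric_sym w) => b.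
  by rewrite ger0_norm; lra.
have {}fv' : mdist (P i) w0 < v by rewrite lt_neqAle fv.
rewrite ltr0_norm ?subr_lt0// in tn *.
have [||||w [ww b]] := nb_extend nb (y := P i) (w := w0) (l := t).
- lra.
- lra.
- exact: wP.
- lra.
exists w; rewrite ww; split=> //; [lra| |by right; apply: btw_sym].
move: b; rewrite /btw ww => b.
by rewrite ler0_norm; lra.
Qed.

End strainers.

(** * Openness of strainer maps *)

Section weights.
Context {R : realType}.
Implicit Types (b : nat -> R) (e : R).

Definition weight i : R := 4^-1 ^+ i.

Lemma weight_gt0 i : 0 < weight i.
Proof. by rewrite exprn_gt0// invr_gt0. Qed.

Lemma weight_le1 i : weight i <= 1.
Proof. by rewrite exprn_ile1// ?invr_ge0// invf_le1// ler1n. Qed.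

Lemma weightS i : 4 * weight i.+1 = weight i.
Proof. by rewrite /weight exprS mulrA divff// mul1r. Qed.

(** The rates of change [b j] of a move for the [i]-th coordinate: the gain
[weight i] of that coordinate exceeds all possible losses of the later ones,
which form a geometric series. The term in [weight k] makes the induction on
[k] go through and leaves a margin at the end. *)
Lemma weighted_sum_le k i b e : (i < k)%N -> 0 <= e -> b i = -1 ->
  (forall j, (j < i)%N -> b j <= e) -> (forall j, (i < j)%N -> b j <= 1) ->
  \sum_(0 <= j < k) weight j * b j <=
    k%:R * e - 2 / 3 * weight i - 4 / 3 * weight k.
Proof.
move=> ik e0 bi bl bg.
have low j : (j <= i)%N -> \sum_(0 <= l < j) weight l * b l <= j%:R * e.
  elim: j => [|j IH] ji; first by rewrite big_geq// mul0r.
  rewrite big_nat_recr//= -natr1 mulrDl mul1r lerD ?IH ?(ltnW ji)//.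
  rewrite (le_trans (ler_wpM2l (ltW (weight_gt0 j)) (bl _ ji)))//.
  by rewrite ler_piMl// weight_le1.
elim: k ik => // k IH; rewrite ltnS leq_eqVlt => /predU1P[<-|ik].
  rewrite big_nat_recr//= bi -natr1 mulrDl mul1r.
  by have := low i (leqnn i); have := weightS i; lra.
rewrite big_nat_recr//= -natr1 mulrDl mul1r.
have : weight k * b k <= weight k * 1.
  by rewrite ler_wpM2l ?bg// ltW// weight_gt0.
by have := IH ik; have := weightS k; lra.
Qed.

End weights.

Section openness.
Context {R : realType} {X : metricType R} {N : set X} (o : X) (r : R).
Context (nb : normal_ball N o r).
Implicit Types (p x y w : X) (e s t : R) (U V W : set X).

(** Minimise over a small closed ball around [y] the weighted distance [F] from
the coordinates of [w] to [v], with a penalty on [d(y, w)] that keeps the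
minimiser away from the boundary of that ball. If some coordinate of the
minimiser were wrong, moving that coordinate would decrease [F]. *)
Lemma strainer_surj W k P e y rho : strainer o r W k P e ->
  0 <= e -> k%:R * e <= weight k -> W y -> 0 < rho ->
  exists2 delta, 0 < delta & forall v : nat -> R,
    (forall i, (i < k)%N -> `|mdist (P i) y - v i| < delta) ->
    exists w, [/\ W w, mdist y w < rho & forall i, (i < k)%N -> mdist (P i) w = v i].
Proof.
move=> S e0 ke Wy rho0.
have [h2 h20 hW] := open_mdist (strainer_open S) Wy.
pose h := Num.min h2 rho / 2.
have h0 : 0 < h by rewrite divr_gt0// lt_min h20.
have [hh2 hrho] : 2 * h <= h2 /\ 2 * h <= rho.
  have -> : 2 * h = Num.min h2 rho by rewrite /h; lra.
  by rewrite !ge_min !lexx orbT.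
have oy := strainer_sub S Wy.
pose K := [set w | mdist y w <= h].
have KW w : K w -> W w by rewrite /K /= => Kw; apply: hW; lra.
have cK : compact K.
  apply: subclosed_compact (nb_compact nb) _; first exact: mdist_closed.
  by move=> w /KW /(strainer_sub S) /=; have := nb_gt0 nb; lra.
pose kap : R := weight k / 3.
have kap0 : 0 < kap by rewrite divr_gt0 ?weight_gt0.
exists (kap * h / k.+1%:R); first by apply: divr_gt0; [exact: mulr_gt0|rewrite ltr0n].
move=> v vP.
pose F w := \sum_(0 <= j < k) weight j * `|mdist (P j) w - v j| + kap * mdist y w.
have sumc n : continuous
    (fun w => \sum_(0 <= j < n) weight j * `|mdist (P j) w - v j| : R).
  elim: n => [|n IH] w.
    by under eq_fun do rewrite big_geq//; exact: cvg_cst.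
  under eq_fun do rewrite big_nat_recr//.
  apply: cvgD; first exact: IH.
  apply: cvgMl_tmp; apply: cvg_norm; apply: cvgB; last exact: cvg_cst.
  exact: mdist_continuous.
have Fc : continuous F.
  move=> w; apply: cvgD; first exact: sumc.
  by apply: cvgMl_tmp; exact: mdist_continuous.
have [|w Kw wmin] := compact_EVT_min _ cK (continuous_subspaceT Fc).
  by exists y; rewrite /K /= mdistxx ltW.
rewrite inE in Kw.
have Fy : F y < kap * h.
  rewrite /F mdistxx mulr0 addr0.
  have : \sum_(0 <= j < k) weight j * `|mdist (P j) y - v j| <=
      \sum_(0 <= j < k) (kap * h / k.+1%:R).
    rewrite big_nat [leRHS]big_nat; apply: ler_sum => j /andP[_ jk].
    rewrite -[leRHS]mul1r ler_pM ?weight_le1 ?(ltW (weight_gt0 _))//.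
    by rewrite ltW ?vP.
  move=> /le_lt_trans; apply.
  rewrite sumr_const_nat subn0 -[ltLHS]mulr_natr mulrAC ltr_pdivrMr ?ltr0n//.
  by rewrite (ltr_pM2l (mulr_gt0 kap0 h0)) ltr_nat.
have wh : mdist y w < h.
  have Fwy : F w <= F y by apply: wmin; rewrite inE /K /= mdistxx ltW.
  rewrite -(ltr_pM2l kap0); apply: le_lt_trans Fy; apply: le_trans Fwy.
  rewrite /F lerDr; apply: sumr_ge0 => j _.
  by rewrite mulr_ge0 ?(ltW (weight_gt0 _)).
exists w; split; [exact: KW|lra|move=> i ik].
apply: contrapT => /eqP wv.
have [w' [w'0 w'h w'v w'b]] := strainer_move nb S (KW _ Kw) ik wv
  (ltac:(lra) : 0 < h - mdist y w).
set t := mdist w w' in w'0 w'h w'v.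
have Kw' : K w' by rewrite /K /=; have := metric_triangle y w w'; rewrite -/t; lra.
have := wmin w' (mem_set Kw'); rewrite leNgt => /negP; apply.
(* the rate at which the error of the [j]-th coordinate grows during the move *)
pose b j := (`|mdist (P j) w' - v j| - `|mdist (P j) w - v j|) / t.
have bE j : `|mdist (P j) w' - v j| - `|mdist (P j) w - v j| <= `|mdist (P j) w' - mdist (P j) w|.
  have -> : mdist (P j) w' - mdist (P j) w = (mdist (P j) w' - v j) - (mdist (P j) w - v j) by ring.
  exact: lerB_dist.
have := @weighted_sum_le R k i b e ik e0 _ _ _.
have -> : \sum_(0 <= j < k) weight j * b j =
   (\sum_(0 <= j < k) weight j * `|mdist (P j) w' - v j| -
    \sum_(0 <= j < k) weight j * `|mdist (P j) w - v j|) / t.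
  rewrite mulrBl !mulr_suml -sumrB; apply: eq_bigr => j _.
  by rewrite /b; ring.
rewrite /F; set A := \sum_(0 <= j < k) _; set B := \sum_(0 <= j < k) _ => H.
have {H} : (A - B) / t <= k%:R * e - 2 / 3 * weight i - 4 / 3 * weight k.
  apply: H.
  - by rewrite /b w'v; field; rewrite gt_eqF.
  - move=> j ji; rewrite /b ler_pdivrMr//; apply: le_trans (bE j) _.
    case: w'b => [b1|b1].
      by rewrite distrC; apply: (strainer_flat S ji ik) => //; exact: KW.
    rewrite /t (metric_sym w).
    by apply: (strainer_flat S ji ik) => //; exact: KW.
  - move=> j ij; rewrite /b ler_pdivrMr// mul1r; apply: le_trans (bE j) _.
    by rewrite /t (metric_sym w); exact: mdist_lipschitz.
rewrite ler_pdivrMr// => AB.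
have yt : kap * mdist y w' <= kap * (mdist y w + t).
  by rewrite ler_pM2l//; exact: metric_triangle.
have wi := weight_gt0 (R := R) i.
have : (k%:R * e - 2 / 3 * weight i - 4 / 3 * weight k + kap) * t < 0.
  rewrite pmulr_llt0//; rewrite /kap; lra.
by move: AB yt; lra.
Qed.

End openness.

(** * Generic smoothness of distance functions *)

Section dichotomy.
Context {R : realType} {X : topologicalType} {T : eqType}.

(** For finitely many families of sets shrinking with the scale, either one of
them is dense in some open set at every scale, or all of them can be avoided at
once. Fixing the family before the scale is what matters: the open set in the
first case serves all scales. *)
Lemma somewhere_dense_or_avoidable (r : R) (L : seq T) (B : T -> R -> set X)
    (W : set X) : 0 < r ->
  (forall l s s', 0 < s' -> s' <= s -> s <= r -> B l s' `<=` B l s) ->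
  open W -> W !=set0 ->
  (exists l U, [/\ open U, U !=set0 & forall s U', 0 < s <= r -> U' `<=` U ->
     open U' -> U' !=set0 -> U' `&` B l s !=set0]) \/
  (exists U s, [/\ open U, U !=set0, U `<=` W, 0 < s <= r
     & forall l, l \in L -> U `&` B l s = set0]).
Proof.
move=> r0 mB; elim: L W => [|l L IH] W oW W0.
  by right; exists W, r; split=> //; rewrite r0 lexx.
have [|] := EM (forall s U', 0 < s <= r -> U' `<=` W ->
     open U' -> U' !=set0 -> U' `&` B l s !=set0).
  by move=> H; left; exists l, W; split.
move=> /existsNP[s /existsNP[U]].
move=> /not_implyP[sr /not_implyP[UW /not_implyP[oU /not_implyP[U0 UB]]]].
have [[l' [U' U'P]]|[U' [s' [oU' U'0 U'U s'r U'B]]]] := IH U oU U0.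
  by left; exists l', U'.
right; exists U', (Num.min s s'); split=> //.
- exact: subset_trans UW.
- by move: sr s'r; rewrite lt_min ge_min => /andP[-> ->] /andP[-> _].
have [s0 [sr' [s'0 s'r']]] : 0 < s /\ s <= r /\ 0 < s' /\ s' <= r.
  by move: sr s'r => /andP[? ?] /andP[? ?].
have m0 : 0 < Num.min s s' by rewrite lt_min s0.
move=> l' /[!inE] /predU1P[->|l'L]; rewrite -subset0 => x [U'x Bx].
  apply: UB; exists x; split; first exact: U'U.
  by apply: mB Bx => //; rewrite ge_min lexx.
rewrite -(U'B l' l'L); split=> //.
by apply: mB Bx => //; rewrite ge_min lexx orbT.
Qed.

End dichotomy.

Section smoothness.
Context {R : realType} {X : metricType R} {N : set X} (o : X) (r : R).
Context (nb : normal_ball N o r).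
Implicit Types (p q x y w a b : X) (e s t : R) (U V W : set X).

Let cN : convex_region N. Proof. exact: (nb_region nb). Qed.
Let sN x : mdist o x <= 9 * r -> N x. Proof. exact: (nb_sub nb). Qed.

(** For a function that is convex along shortest paths, the second difference
measures the jump of the slope at [x]; smallness relative to the scale [s] is
almost differentiability in all directions at once. *)
Definition smooth_at p e s x : Prop := forall a b,
  mdist x a = s -> mdist x b = s -> btw a x b ->
  mdist p a + mdist p b - 2 * mdist p x < e * s.

(** A failure of [smooth_at] at [x], on a path that extends to length [r] on
either side with its ends near [q] and [q']. Recording the ends up to [eta]
leaves finitely many types of kinks, by compactness. *)
Definition kink p q q' e eta s x : Prop := exists a b A B,
  [/\ [/\ mdist x a = s, mdist x b = s & e * s <= mdist p a + mdist p b - 2 * mdist p x],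
      [/\ mdist x A = r, mdist x B = r & btw A x B],
      btw x a A /\ btw x b B & mdist q A < eta /\ mdist q' B < eta].

Lemma dist_slope_monotone p x a a2 s s' : mdist o p < r -> mdist o x < r ->
  s' <= r -> 0 <= s -> btw x a a2 -> mdist x a = s -> mdist x a2 = s' ->
  s' * (mdist p a - mdist p x) <= s * (mdist p a2 - mdist p x).
Proof.
move=> op ox s'r s0 b xa xa2; have r0 := nb_gt0 nb.
have ss' : s <= s' by rewrite -xa -xa2 b; have := mdist_ge0 a a2; lra.
have NN z : mdist x z <= r -> N z.
  by move=> xz; apply: sN; have := metric_triangle o x z; lra.
have H : [/\ N p, N x, N a & N a2] by split; [apply: sN; lra|apply: sN; lra|apply: NN; lra..].
have := region_dist_convex cN H b; rewrite xa xa2.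
have -> : mdist a a2 = s' - s by move: b; rewrite /btw; lra.
lra.
Qed.

(** The quotient of the second difference by the scale is nondecreasing in the
scale, by convexity, and the path to [A] and [B] provides the points at the
larger scale. *)
Lemma kink_mono p q q' e eta s s' x : mdist o p < r -> mdist o x < r ->
  0 < s' -> s' <= s -> s <= r -> kink p q q' e eta s' x -> kink p q q' e eta s x.
Proof.
move=> op ox s'0 s's sr [a [b [A [B [[xa xb k] [xA xB AB] [xaA xbB] qq]]]]].
have r0 := nb_gt0 nb.
have NN z : mdist x z <= r -> N z.
  by move=> xz; apply: sN; have := metric_triangle o x z; lra.
have ext z Z : mdist x z = s' -> mdist x Z = r -> btw x z Z ->
    exists z', [/\ mdist x z' = s, btw x z z' & btw x z' Z].
  move=> xz xZ bz; have [|||z' [_ zz' bz']] := region_point cN (y := z) (a := Z) (s := s - s').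
  - by apply: NN; lra.
  - by apply: NN; lra.
  - by move: bz; rewrite /btw; lra.
  have [b1 b2] := btw_trans bz bz'.
  by exists z'; split=> //; rewrite b1; lra.
have [a' [xa' ba' ba'A]] := ext _ _ xa xA xaA.
have [b' [xb' bb' bb'B]] := ext _ _ xb xB xbB.
exists a', b', A, B; split=> //; split=> //.
have := dist_slope_monotone op ox sr (ltW s'0) ba' xa xa'.
have := dist_slope_monotone op ox sr (ltW s'0) bb' xb xb'.
have : s * (e * s') <= s * (mdist p a + mdist p b - 2 * mdist p x).
  by rewrite ler_pM2l//; lra.
move=> h1 h2 h3; rewrite -(ler_pM2l s'0); lra.
Qed.

(** Two paths with starting points that are close relative to [s / r], and with
ends at distance [r] that are close, remain close relative to [s / r] at
distance [s]; so do the distances to [p]. *)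
Lemma fellow_value p x y z Z w C e s : 0 < s -> s <= r -> 0 < e ->
  [/\ N y, N Z & N z] -> [/\ N x, N C & N w] ->
  [/\ mdist y z = s, mdist y Z = r & btw y z Z] ->
  [/\ mdist x w = s, mdist x C = r & btw x w C] ->
  mdist x y < e * (s / r) -> mdist Z C <= 3 * e ->
  mdist p z - 4 * (e * (s / r)) <= mdist p w.
Proof.
move=> s0 sr e0 Ny Nx [yz yZ bz] [xw xC bw] xy ZC; have r0 := nb_gt0 nb.
have sr0 : 0 <= s <= r by rewrite sr ltW.
have zw := region_fellow cN Ny Nx sr0 r0 bz bw yZ xC yz xw.
have q0 : 0 <= s / r by rewrite divr_ge0 ?ltW.
have q1 : s / r <= 1 by rewrite ler_pdivrMr// mul1r.
have e1 : (1 - s / r) * mdist y x <= 1 * (e * (s / r)).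
  apply: ler_pM; [lra|exact: mdist_ge0|lra|].
  by rewrite metric_sym ltW.
have e2 := ler_wpM2l q0 ZC.
have := metric_triangle p w z; rewrite (metric_sym w z).
move: zw e1 e2; clear -nb cN sN; lra.
Qed.

(** A kink at [y] with ends near those of a path [c] forces the distance to [p]
to bend along [c] where [c] passes near [y]. Both halves of the kink fellow
travel with [c], and at scale [s] the error is proportional to [s], with a
factor that is small compared with [e]: the second difference loses at most
[10 * (e * s / 20)], half of its size. *)
Lemma kink_second_difference p q q' e s u y (c : R -> X) : 0 < e -> 0 < s ->
  s <= u -> u <= e * r / 20 -> u <= r -> mdist o y < r ->
  shortest_path 0 (3 * r) c -> (forall t, 0 <= t <= 3 * r -> N (c t)) ->
  mdist q (c 0) < e * r / 20 -> mdist q' (c (2 * r)) < e * r / 20 ->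
  mdist (c (r + u)) y < e * r / 20 * (s / r) ->
  kink p q q' e (e * r / 20) s y ->
  e * s / 2 <= mdist p (c (r + u + s)) + mdist p (c (r + u - s)) - 2 * mdist p (c (r + u)).
Proof.
have r0 := nb_gt0 nb.
set eta := e * r / 20.
have eta0 : 0 < e -> 0 < eta by move=> e0; rewrite divr_gt0 ?mulr_gt0.
have etaE : eta * (s / r) = e * s / 20 by rewrite /eta; field; rewrite gt_eqF.
move: eta eta0 etaE => eta eta0 etaE.
move=> e0 s0 su ueta ur oy cE cN' qA qB xy.
move=> [a [b [A [B [[ya yb k] [yA yB _] [yaA ybB] [qA' qB']]]]]].
have {}eta0 := eta0 e0.
have sr : s <= r by exact: le_trans ur.
have yN z : mdist y z <= r -> N z.
  by move=> yz; apply: sN; have := metric_triangle o y z; move: oy yz r0; clear -nb cN sN; lra.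
have NY : N y by apply: yN; rewrite mdistxx ltW.
have [Na Nb NA NB] : [/\ N a, N b, N A & N B].
  by split; apply: yN; rewrite ?ya ?yb ?yA ?yB.
have NC t : 0 <= t -> t <= 3 * r -> N (c t) by move=> t0 t3; apply: cN'; rewrite t0.
set x := c (r + u) in xy *.
have Nx : N x by apply: NC; move: r0 s0 su ur; clear -nb cN sN; lra.
have hB : mdist p b - 4 * (eta * (s / r)) <= mdist p (c (r + u + s)).
  have BC : mdist B (c (2 * r + u)) <= 3 * eta.
    have : mdist (c (2 * r)) (c (2 * r + u)) = u.
      by rewrite (path_dist cE); move: r0 s0 su ur; clear -nb cN sN; lra.
    have := metric_triangle B q' (c (2 * r + u)).
    have := metric_triangle q' (c (2 * r)) (c (2 * r + u)).
    by rewrite (metric_sym B q'); move: qB qB' ueta; clear -nb cN sN; lra.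
  apply: (fellow_value p s0 sr eta0 (And3 NY NB Nb) _ (And3 yb yB ybB) _ xy BC).
    by split=> //; apply: NC; move: r0 s0 su ur; clear -nb cN sN; lra.
  rewrite /x; split; last by apply: (path_btw cE); move: r0 s0 su ur; clear -nb cN sN; lra.
    by rewrite (path_dist cE); move: r0 s0 su ur; clear -nb cN sN; lra.
  by rewrite (path_dist cE); move: r0 s0 su ur; clear -nb cN sN; lra.
have hA : mdist p a - 4 * (eta * (s / r)) <= mdist p (c (r + u - s)).
  have AC : mdist A (c u) <= 3 * eta.
    have : mdist (c 0) (c u) = u.
      by rewrite (path_dist cE); move: r0 s0 su ur; clear -nb cN sN; lra.
    have := metric_triangle A q (c u); have := metric_triangle q (c 0) (c u).
    by rewrite (metric_sym A q); move: qA qA' ueta; clear -nb cN sN; lra.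
  apply: (fellow_value p s0 sr eta0 (And3 NY NA Na) _ (And3 ya yA yaA) _ xy AC).
    by split=> //; apply: NC; move: r0 s0 su ur; clear -nb cN sN; lra.
  rewrite /x; split.
  - by rewrite metric_sym (path_dist cE); move: r0 s0 su ur; clear -nb cN sN; lra.
  - by rewrite metric_sym (path_dist cE); move: r0 s0 su ur; clear -nb cN sN; lra.
  - by apply: btw_sym; apply: (path_btw cE); move: r0 s0 su ur; clear -nb cN sN; lra.
have hx : mdist p x <= mdist p y + eta * (s / r).
  by have := metric_triangle p y x; rewrite (metric_sym y x); move: xy; clear -nb cN sN; lra.
by move: hA hB hx k; rewrite etaE; clear -nb cN sN; lra.
Qed.

(** Suppose kinks with ends near [q] and [q'] are dense at every scale, and let
[c] be the path of one of them. At each of the points [g j], which follow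
each other at distance [s] along [c], there is a kink of scale [s] nearby, so the slope of the
distance to [p] grows by at least [e / 2] from step to step. After [n] steps it
has grown by more than [2], while it lies between [-1] and [1]. *)
Lemma kinks_not_dense p q q' e U : mdist o p < r -> 0 < e -> open U ->
  U !=set0 -> (forall x, U x -> mdist o x < r) ->
  ~ (forall s U', 0 < s <= r -> U' `<=` U -> open U' -> U' !=set0 ->
      U' `&` kink p q q' e (e * r / 20) s !=set0).
Proof.
move=> op e0 oU U0 Ur H; have r0 := nb_gt0 nb.
have [] := H r U _ (fun=> id) oU U0; first by rewrite r0 lexx.
move=> x1 [Ux1 [_ [_ [A1 [B1 [_ [xA xB AxB] _ [qA qB]]]]]]].
have ox1 := Ur _ Ux1.
have [z2 z20 zU] := open_mdist oU Ux1.
have oA1 : mdist o A1 <= 2 * r by have := metric_triangle o x1 A1; lra.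
have oB1 : mdist o B1 <= 2 * r by have := metric_triangle o x1 B1; lra.
have A1x1 : mdist A1 x1 = r by rewrite metric_sym.
have AB1 : mdist A1 B1 = 2 * r by rewrite AxB metric_sym; lra.
have [||||B2 [BB2 bB]] := nb_extend nb (y := A1) (w := B1) (l := r).
- lra.
- lra.
- by move=> E; move: AB1; rewrite E mdistxx; lra.
- lra.
have AB2 : mdist A1 B2 = 3 * r by rewrite bB; lra.
have oB2 : mdist o B2 <= 3 * r by have := metric_triangle o B1 B2; lra.
have [NA1 NB1 NB2 Nx1] : [/\ N A1, N B1, N B2 & N x1].
  by split; apply: sN; move: r0 oA1 oB1 oB2 ox1; clear -nb cN sN; lra.
have [c [cE c0 cD cN']] := region_path cN NA1 NB2.
have cr : c r = x1.
  rewrite -A1x1; apply: (region_unique cN NA1 NB2 cE) => //.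
    by apply: cN'; rewrite A1x1 AB2; lra.
  have := metric_triangle x1 B1 B2; have := metric_triangle A1 x1 B2.
  by move: AxB bB; rewrite /btw; lra.
have c2r : c (2 * r) = B1.
  rewrite -AB1; apply: (region_unique cN NA1 NB2 cE) => //.
  by apply: cN'; rewrite AB1 AB2; lra.
rewrite AB2 in cE cN'; rewrite -c0 in qA; rewrite -c2r in qB.
move: cr r0 cE cN' qA qB zU z20 H e0 Ur op oU.
clear -nb cN sN=> cr r0 cE cN' qA qB zU z20 H e0 Ur op oU.
set eta := e * r / 20 in qA qB H.
have eta0 : 0 < eta by rewrite divr_gt0 ?mulr_gt0.
(* the number of steps is fixed before their length [s] *)
have [n nP] : exists n : nat, 4 < n%:R * e.
  exists (Num.truncn (4 / e)).+1; rewrite -ltr_pdivrMr//.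
  exact: truncnS_gt.
have [s s0 sn] : exists2 s, 0 < s & forall m, (m <= n.+1)%N ->
    [/\ m%:R * s < z2, m%:R * s <= eta & m%:R * s <= r].
  pose h := Num.min (z2 / 2) (Num.min eta r).
  have h0 : 0 < h by rewrite !lt_min eta0 r0; lra.
  have [hz heta hr] : [/\ h <= z2 / 2, h <= eta & h <= r].
    by rewrite /h !ge_min !lexx !orbT.
  have n0 : 0 < n.+1%:R :> R by rewrite ltr0n.
  exists (h / n.+1%:R) => [|m mn]; first exact: divr_gt0.
  have : m%:R * (h / n.+1%:R) <= h.
    by rewrite mulrCA ger_pMr// ler_pdivrMr// mul1r ler_nat.
  move=> mh; split; [apply: le_lt_trans mh _; lra|exact: le_trans heta|exact: le_trans hr].
have sr : s <= r by have [_ _] := sn 1%N isT; rewrite mul1r.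
pose g (j : nat) := c (r + j%:R * s).
have gS m : g m.+1 = c (r + m%:R * s + s) by rewrite /g -natr1 mulrDl mul1r addrA.
have step m : (m < n)%N ->
    e * s / 2 <= mdist p (g m.+2) + mdist p (g m) - 2 * mdist p (g m.+1).
  move=> mn; have [uz ueta ur] := sn m.+1 (leqW mn).
  have su : s <= m.+1%:R * s by rewrite ler_peMl// ?ler1n// ltW.
  have gP : g m = c (r + m.+1%:R * s - s).
    by rewrite -natr1 mulrDl mul1r addrA addrK.
  have Ux : U (g m.+1).
    by apply: zU; rewrite -cr (path_dist cE); move: r0 uz ur su s0; clear -nb cN sN; lra.
  have es0 : 0 < eta * (s / r) by rewrite mulr_gt0// divr_gt0.
  have [||||y [[Uy xy] ky]] := H s (U `&` [set z | mdist (g m.+1) z < eta * (s / r)]).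
  - by rewrite s0.
  - by move=> z [].
  - by apply: openI => //; exact: mdist_open.
  - by exists (g m.+1); split=> //=; rewrite mdistxx.
  rewrite gP (gS m.+1).
  exact: (kink_second_difference e0 s0 su ueta ur (Ur _ Uy) cE cN' qA qB xy ky).
have lip j : (j <= n)%N -> `|mdist p (g j.+1) - mdist p (g j)| <= s.
  move=> jn; apply: le_trans (mdist_lipschitz _ _ _) _.
  have j0 : 0 <= j%:R * s by rewrite mulr_ge0// ltW.
  have [_ _] := sn j.+1 jn; rewrite metric_sym gS -natr1 mulrDl mul1r => ur.
  by rewrite (path_dist cE); move: r0 ur j0 s0; clear -nb cN sN; lra.
have grow m : (m <= n)%N ->
    mdist p (g 1%N) - mdist p (g 0%N) + m%:R * (e * s / 2) <= mdist p (g m.+1) - mdist p (g m).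
  elim: m => [|m IH] mn; first by rewrite mul0r addr0.
  have := step m mn; have := IH (ltnW mn); rewrite -natr1 mulrDl mul1r; clear -nb cN sN; lra.
have := grow n (leqnn n); have := lip n (leqnn n); have := lip 0%N isT.
have : 4 * s < n%:R * e * s by rewrite ltr_pM2r.
rewrite !ler_norml; clear -nb cN sN => h /andP[l1 _] /andP[_ l2] l3; lra.
Qed.

(** Otherwise kinks of finitely many types would be unavoidable, hence those of
one type dense in some open set at every scale. *)
Lemma generic_smooth W k (P : nat -> X) e : open W -> W !=set0 ->
  (forall x, W x -> mdist o x < r) -> (forall i, (i < k)%N -> mdist o (P i) < r) ->
  0 < e -> exists U s, [/\ open U, U !=set0, U `<=` W, 0 < s <= r
    & forall x i, U x -> (i < k)%N -> smooth_at (P i) e s x].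
Proof.
move=> oW W0 Wr Pr e0; have r0 := nb_gt0 nb.
have eta0 : 0 < e * r / 20 by rewrite divr_gt0 ?mulr_gt0.
have [D DP] := compact_net (nb_compact nb) eta0.
pose L := [seq (i, qq) | i <- iota 0 k, qq <- [seq (q, q') | q <- D, q' <- D]].
pose B (l : nat * (X * X)) s := [set x | [/\ (l.1 < k)%N, W x &
  kink (P l.1) l.2.1 l.2.2 e (e * r / 20) s x]].
have [|[[i [q q']] [U [oU U0 H]]]|] :=
    @somewhere_dense_or_avoidable R X _ r L B W r0 _ oW W0.
- move=> l s s' s'0 s's sr x [lk Wx K]; split=> //.
  by apply: kink_mono K => //; [exact: Pr|exact: Wr].
- exfalso; have [x [Ux [/= ik _ _]]] := H r U (ltac:(lra) : 0 < r <= r) (fun=> id) oU U0.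
  have oUW : open (U `&` W) by exact: openI.
  have UW0 : U `&` W !=set0.
    by have [z [Uz [_ Wz _]]] := H r U (ltac:(lra) : 0 < r <= r) (fun=> id) oU U0; exists z.
  apply: (@kinks_not_dense (P i) q q' e (U `&` W) (Pr _ ik) e0 oUW UW0).
    by move=> z [_ Wz]; exact: Wr.
  move=> s U' sr U'U oU' U'0.
  have [z [U'z [_ _ kz]]] := H s U' sr (fun z U'z => (U'U z U'z).1) oU' U'0.
  by exists z.
move=> [U [s [oU U0 UW sr H]]]; exists U, s; split=> // x i Ux ik a b xa xb axb.
rewrite ltNge; apply/negP => K.
have [s0 s_r] : 0 < s /\ s <= r by move: sr => /andP.
have ox := Wr _ (UW _ Ux).
have oa : mdist o a <= 2 * r by have := metric_triangle o x a; lra.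
have ob : mdist o b <= 2 * r by have := metric_triangle o x b; lra.
have ab : mdist a b = 2 * s by rewrite axb (metric_sym a); lra.
have [||||A [aA bA]] := nb_extend nb (y := b) (w := a) (l := r - s).
- lra.
- lra.
- by move=> E; move: ab; rewrite E mdistxx; lra.
- lra.
have oA : mdist o A <= 4 * r by have := metric_triangle o a A; lra.
have Ab : mdist A b = s + r by move: bA; rewrite /btw (metric_sym b a) (metric_sym b A); lra.
have [||||B' [bB AB]] := nb_extend nb (y := A) (w := b) (l := r - s).
- lra.
- lra.
- by move=> E; move: Ab; rewrite E mdistxx; lra.
- lra.
have AB2 : mdist A B' = 2 * r by rewrite AB; lra.
have xA := metric_triangle x a A; have xB := metric_triangle x b B'.
have AxB := metric_triangle A x B'; rewrite (metric_sym A x) in AxB.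
have oA3 : mdist o A <= 9 * r by lra.
have oB : mdist o B' <= 9 * r by have := metric_triangle o b B'; lra.
have [q qD qA] := DP _ oA3; have [q' q'D qB] := DP _ oB.
have lL : (i, (q, q')) \in L.
  by rewrite !allpairs_f// mem_iota.
suff : (U `&` B (i, (q, q')) s) x by rewrite (H _ lL).
split=> //; split=> //=; first exact: UW.
by exists a, b, A, B'; rewrite /btw (metric_sym A x); split; split; lra.
Qed.

End smoothness.

(** * Strainers that cannot be lengthened *)

Section maximal_strainers.
Context {R : realType} {X : metricType R} {N : set X} (o : X) (r : R).
Context (nb : normal_ball N o r).
Implicit Types (p q x y z w a b : X) (e s t : R) (U V W : set X).

Let cN : convex_region N. Proof. exact: (nb_region nb). Qed.
Let sN x : mdist o x <= 9 * r -> N x. Proof. exact: (nb_sub nb). Qed.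

Definition separates k (P : nat -> X) U : Prop := forall y z, U y -> U z ->
  (forall i, (i < k)%N -> mdist (P i) y = mdist (P i) z) -> y = z.

(** Extend the path from [y] through [w] to [z] to a path from [a] to [b] centred
at [w] at the scale [s] of smoothness. The slope from [w] to [b] is at least
that from [w] to [z], hence almost nonnegative; smoothness then bounds the slope
from [w] to [a] from above, and the slope from [w] to [y] is no larger. *)
Lemma smooth_flat p e s w y z : mdist o p < r -> 0 < s <= r ->
  mdist o w < r -> mdist o y < r -> mdist o z < r ->
  smooth_at p (e / 2) s w -> w <> y -> w <> z -> y <> z ->
  mdist w y <= s -> mdist w z <= s -> btw y w z ->
  - (e / 2 * mdist w z) <= mdist p z - mdist p w ->
  mdist p y - mdist p w <= e * mdist y w.
Proof.
move=> op /andP[s0 sr] ow oy oz sm wy wz yz wys wzs ywz low.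
have wy0 : 0 < mdist w y by rewrite mdist_gt0; apply/eqP.
have wz0 : 0 < mdist w z by rewrite mdist_gt0; apply/eqP.
have [||||b [zb yzb]] := nb_extend nb (y := y) (w := z) (l := s - mdist w z).
- lra.
- lra.
- exact: yz.
- lra.
have ob : mdist o b <= 2 * r by have := metric_triangle o z b; lra.
have yb : mdist y b = mdist w y + s.
  by move: ywz yzb; rewrite /btw (metric_sym w y); lra.
have wb : mdist w b = s.
  have := metric_triangle w z b; have := metric_triangle y w b.
  by rewrite (metric_sym y w); lra.
have [||||a [ya bya]] := nb_extend nb (y := b) (w := y) (l := s - mdist w y).
- lra.
- lra.
- by move=> E; move: yb; rewrite E mdistxx; lra.
- lra.
have ab : mdist b a = 2 * s by move: bya; rewrite /btw (metric_sym b y); lra.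
have wa : mdist w a = s.
  have := metric_triangle w y a; have := metric_triangle b w a.
  by rewrite (metric_sym b w); lra.
have awb : btw a w b by rewrite /btw (metric_sym a b) (metric_sym a w); lra.
have wza : btw w y a by rewrite /btw; lra.
have wzb : btw w z b by rewrite /btw; lra.
have S := sm a b wa wb awb.
have h1 := dist_slope_monotone nb op ow sr (ltW wz0) wzb erefl wb.
have h2 := dist_slope_monotone nb op ow sr (ltW wy0) wza erefl wa.
have h3 : - (e / 2 * s) <= mdist p b - mdist p w.
  rewrite -(ler_pM2l wz0); apply: le_trans h1.
  by have := ler_wpM2l (ltW s0) low; lra.
rewrite -(ler_pM2l s0) (metric_sym y w); apply: le_trans h2 _.
have -> : s * (e * mdist w y) = mdist w y * (e * s) by ring.
by rewrite ler_pM2l//; lra.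
Qed.

(** If the distances do not separate the points of a small set of smoothness,
two points [y] and [z] at which they agree give the new straining point [z] on a
neighborhood of [y]. The distance to [P i] grows slowly towards [z] by
convexity, since it is almost the same at [z], and away from [z] by
[smooth_flat]. *)
Lemma strainer_step W k P e : strainer o r W k P e -> W !=set0 -> 0 < e <= 1 ->
  (exists U, [/\ open U, U !=set0, U `<=` W & separates k P U]) \/
  (exists P' W', [/\ W' !=set0, W' `<=` W & strainer o r W' k.+1 P' e]).
Proof.
move=> S W0 /andP[e0 e1].
have [U [s [oU [x Ux] UW sr US]]] := generic_smooth nb (strainer_open S) W0
  (strainer_sub S) (fun i ik => (strainer_pts S ik).1) (ltac:(lra) : 0 < e / 2).
have [s0 s_r] : 0 < s /\ s <= r by move: sr => /andP.
pose U1 := U `&` [set y | mdist x y < s / 2].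
have oU1 : open U1 by apply: openI => //; exact: mdist_open.
have U1x : U1 x by split=> //=; rewrite mdistxx; lra.
have U1W : U1 `<=` W by move=> y [/UW].
have [sep|] := EM (separates k P U1); first by left; exists U1; split=> //; exists x.
move=> /existsNP[y /existsNP[z]].
move=> /not_implyP[U1y /not_implyP[U1z /not_implyP[yzP yz]]]; right.
set D := mdist y z; pose d := e / 2 * D / 2.
have D0 : 0 < D by rewrite mdist_gt0; apply/eqP.
have eD : e * D <= D by rewrite ler_piMl// ltW.
have d0 : 0 < d by rewrite divr_gt0 ?mulr_gt0//; lra.
have dD : d <= D / 4 by rewrite /d; lra.
pose W' := U1 `&` [set w | mdist y w < d].
pose P' i := if (i < k)%N then P i else z.
have P'lt i : (i < k)%N -> P' i = P i by rewrite /P' => ->.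
exists P', W'; split.
- by exists y; split=> //=; rewrite mdistxx.
- by move=> w [/U1W].
have W'W w : W' w -> W w by move=> [/U1W].
have W'z : ~ W' z by move=> [_ /=]; rewrite -/D; lra.
have W'o w : W' w -> mdist o w < r by move=> /W'W /(strainer_sub S).
split=> //.
- by apply: openI => //; exact: mdist_open.
- move=> i; rewrite ltnS leq_eqVlt => /predU1P[->|ik].
    rewrite /P' ltnn; split=> //; exact: (strainer_sub S (U1W _ U1z)).
  by rewrite P'lt//; have [? WP] := strainer_pts S ik; split=> // /W'W.
move=> i j ij; rewrite ltnS leq_eqVlt => /predU1P[jk|jk]; last first.
  move=> u w /W'W Wu /W'W Ww; rewrite !P'lt//; last exact: ltn_trans jk.
  exact: (strainer_flat S ij jk).
subst j => u w W'u W'w; rewrite (P'lt _ ij) /P' ltnn => uwz.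
have [op _] := strainer_pts S ij.
have oz := strainer_sub S (U1W _ U1z).
have ou := W'o _ W'u; have ow := W'o _ W'w.
have uz : u <> z by move=> E; apply: W'z; rewrite -E.
have wz : w <> z by move=> E; apply: W'z; rewrite -E.
have close v : W' v -> `|mdist (P i) z - mdist (P i) v| <= e / 2 * mdist v z.
  move=> [_ /= yv]; rewrite -(yzP _ ij).
  apply: le_trans (mdist_lipschitz _ _ _) _; apply: le_trans (ltW yv) _.
  have vz : D / 2 <= mdist v z by have := metric_triangle y v z; rewrite -/D; lra.
  by have := ler_wpM2l (ltac:(lra) : 0 <= e / 2) vz; rewrite /d; lra.
have NN v : mdist o v < r -> N v by move=> ov; apply: sN; have := nb_gt0 nb; lra.
rewrite ler_norml; apply/andP; split; last first.
  have [->|/eqP wu] := eqVneq w u; first by rewrite subrr mdistxx mulr0.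
  have sx v : W' v -> mdist x v < s / 2 by move=> [[]].
  have sU : U w by case: W'w => -[].
  have tri v : W' v -> mdist w v <= s.
    by move=> /sx xv; have := metric_triangle w x v; have := sx _ W'w; rewrite (metric_sym w x); lra.
  apply: (smooth_flat op sr ow ou oz (US _ _ sU ij) wu wz uz (tri _ W'u) _ uwz).
    case: U1z => _ /= xz; have := metric_triangle w x z; have := sx _ W'w.
    by rewrite (metric_sym w x); lra.
  by have := close _ W'w; rewrite ler_norml => /andP[].
have uz0 : 0 < mdist u z by rewrite mdist_gt0; apply/eqP.
have := region_dist_convex cN (And4 (NN _ op) (NN _ ou) (NN _ ow) (NN _ oz)) uwz.
have := close _ W'u; rewrite ler_norml => /andP[_ cu].
have -> : mdist w z = mdist u z - mdist u w by move: uwz; rewrite /btw; lra.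
move=> conv.
have cu' := ler_wpM2l (mdist_ge0 u w) cu.
have : mdist u z * (mdist (P i) w - mdist (P i) u) <= mdist u z * (e / 2 * mdist u w).
  lra.
rewrite ler_pM2l// => h.
have : 0 <= e * mdist u w by rewrite mulr_ge0 ?mdist_ge0// ltW.
lra.
Qed.

(** Starting from the empty strainer, lengthening must stop by
[strainer_bound]. The bound [M] holds for all [e <= 1 / 2], so [e] may be chosen
after [M], small enough for [strainer_surj] to apply to every length up to
[M]. *)
Lemma exists_coordinates : exists k P W, [/\ open W, W !=set0,
  forall x, W x -> mdist o x < r, separates k P W
  & forall y rho, W y -> 0 < rho -> exists2 delta, 0 < delta &
    forall v : nat -> R, (forall i, (i < k)%N -> `|mdist (P i) y - v i| < delta) ->
    exists w, [/\ W w, mdist y w < rho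
      & forall i, (i < k)%N -> mdist (P i) w = v i]].
Proof.
have [M MP] := strainer_bound nb.
pose e : R := weight M / M.+2%:R.
have M0 : 0 < M.+2%:R :> R by rewrite ltr0n.
have e0 : 0 < e by rewrite divr_gt0 ?weight_gt0.
have M2 : (2 : R) <= M.+2%:R by rewrite ler_nat.
have eM : e * M.+2%:R = weight M by rewrite /e divfK// gt_eqF.
have e2 : e <= 1 / 2.
  have := ler_wpM2l (ltW e0) M2; rewrite eM.
  by have := weight_le1 (R := R) M; lra.
have wmono k : (k <= M)%N -> weight M <= weight k :> R.
  by move=> kM; rewrite /weight; apply: ler_wiXn2l; rewrite ?invr_ge0 ?invf_le1 ?ler1n.
have ke k : (k <= M)%N -> k%:R * e <= weight k.
  move=> kM; apply: le_trans (wmono _ kM); rewrite -eM mulrC ler_wpM2l ?(ltW e0)//.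
  by rewrite ler_nat (leq_trans kM)// -addn2 leq_addr.
have r0 := nb_gt0 nb.
have start : strainer o r [set x | mdist o x < r] 0 (fun=> o) e.
  by split=> //; exact: mdist_open.
suff H n k W P : (M - k <= n)%N -> W !=set0 -> strainer o r W k P e ->
    exists k P U, [/\ strainer o r U k P e, U !=set0 & separates k P U].
  have [|k [P [U [S U0 sep]]]] := H M 0%N _ _ (leq_subr _ _) _ start.
    by exists o; rewrite /= mdistxx.
  exists k, P, U; split=> //; [exact: strainer_open S|exact: strainer_sub S|].
  move=> y rho Uy rho0; apply: (strainer_surj nb S (ltW e0)) => //.
  exact: ke (MP _ _ _ _ S U0 e2).
elim: n k W P => [|n IH] k W P kn W0 S;
    (have [[U [oU U0 UW sep]]|[P' [W' [W'0 W'W S']]]] :=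
       strainer_step S W0 (ltac:(lra) : 0 < e <= 1);
    first by exists k, P, U; split=> //; split=> //;
      [move=> x /UW; exact: (strainer_sub S)
      |move=> i /(strainer_pts S)[? WP]; split=> // /UW
      |move=> i j ij jk y w /UW Wy /UW Ww; exact: (strainer_flat S)]).
- have := MP _ _ _ _ S' W'0 e2.
  by move: kn; rewrite leqn0 subn_eq0 => Mk kM; have := leq_trans kM Mk; rewrite ltnn.
- apply: (IH k.+1 W' P') => //.
  by have kM := MP _ _ _ _ S' W'0 e2; rewrite subnS -ltnS prednK ?subn_gt0.
Qed.

End maximal_strainers.

(** * From coordinates to manifold points *)

Section ball_homeomorphism.
Context {R : realType} {n : nat}.
Implicit Types (u y : 'rV[R]_n) (d : R).

Definition shrink d u : 'rV[R]_n := (d / (1 + `|u|)) *: u.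

Definition stretch d y : 'rV[R]_n := (d - `|y|)^-1 *: y.

Lemma shrink_den_gt0 u : 0 < 1 + `|u|.
Proof. by rewrite ltr_pwDl. Qed.

Lemma norm_shrink d u : 0 < d -> `|shrink d u| = d / (1 + `|u|) * `|u|.
Proof.
by move=> d0; rewrite normrZ ger0_norm// divr_ge0 ?(ltW d0) ?(ltW (shrink_den_gt0 u)).
Qed.

Lemma norm_shrink_lt d u : 0 < d -> `|shrink d u| < d.
Proof.
move=> d0; have u1 := shrink_den_gt0 u.
by rewrite norm_shrink// mulrAC ltr_pdivrMr// ltr_pM2l//; lra.
Qed.

Lemma stretchK d y : `|y| < d -> shrink d (stretch d y) = y.
Proof.
move=> yd; have dy : 0 < d - `|y| by lra.
rewrite /shrink /stretch normrZ ger0_norm ?invr_ge0 ?(ltW dy)// scalerA.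
have d0 : d != 0 by have := normr_ge0 y; move: dy => ? ?; rewrite gt_eqF//; lra.
suff -> : d / (1 + (d - `|y|)^-1 * `|y|) * (d - `|y|)^-1 = 1 by rewrite scale1r.
by field; rewrite (gt_eqF dy)/= subrK d0.
Qed.

Lemma shrinkK d u : 0 < d -> stretch d (shrink d u) = u.
Proof.
move=> d0; have u1 := shrink_den_gt0 u.
rewrite /stretch norm_shrink// /shrink scalerA.
suff -> : (d - d / (1 + `|u|) * `|u|)^-1 * (d / (1 + `|u|)) = 1 by rewrite scale1r.
have -> : d - d / (1 + `|u|) * `|u| = d / (1 + `|u|) by field; rewrite gt_eqF.
by rewrite mulVf// mulf_neq0 ?invr_neq0// gt_eqF.
Qed.

Lemma norm_inv_continuous (f : R -> R) u : f `|u| != 0 -> continuous f ->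
  {for u, continuous (fun u : 'rV[R]_n => (f `|u|)^-1)}.
Proof.
move=> fu cf; apply: (@continuousV _ _ (fun u : 'rV[R]_n => f `|u|)) => //.
apply: (@continuous_comp _ _ _ (fun u : 'rV[R]_n => `|u|) f).
  exact: norm_continuous.
exact: cf.
Qed.

Lemma shrink_continuous d : continuous (shrink d).
Proof.
move=> u.
have c1 : {for u, continuous (fun u : 'rV[R]_n => (1 + `|u|)^-1)}.
  apply: (@norm_inv_continuous (fun x => 1 + x)).
    by rewrite /= gt_eqF// shrink_den_gt0.
  by move=> x; apply: continuousD; [exact: cvg_cst|exact: cvg_id].
have c2 : {for u, continuous (fun u : 'rV[R]_n => d * (1 + `|u|)^-1)}.
  exact: (cvgMl_tmp c1).
by have := continuousZ c2 cvg_id; exact.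
Qed.

Lemma stretch_continuous d y : `|y| < d -> {for y, continuous (stretch d)}.
Proof.
move=> yd.
have c1 : {for y, continuous (fun u : 'rV[R]_n => (d - `|u|)^-1)}.
  apply: (@norm_inv_continuous (fun x => d - x)).
    by rewrite /= gt_eqF// subr_gt0.
  by move=> x; apply: continuousB; [exact: cvg_cst|exact: cvg_id].
by have := continuousZ c1 cvg_id; exact.
Qed.

Lemma norm_lt_coord u y d : 0 < d ->
  `|u - y| < d <-> forall i, `|u 0 i - y 0 i| < d.
Proof.
move=> d0; have -> : (`|u - y| < d) = (ball u d y) :> Prop by rewrite -ball_normE.
split=> [[_ H] i|H]; first exact: H.
by split=> // i j; rewrite ord1; exact: H.
Qed.

End ball_homeomorphism.

Section coordinates.
Context {R : realType} {X : metricType R}.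

Definition distance_map k (P : nat -> X) (w : X) : 'rV[R]_k :=
  \row_(i < k) mdist (P i) w.

Lemma distance_map_lipschitz k P x y d : 0 < d -> mdist x y < d ->
  `|distance_map k P x - distance_map k P y| < d.
Proof.
move=> d0 xy; apply/norm_lt_coord => // i; rewrite !mxE.
exact: le_lt_trans (mdist_lipschitz _ _ _) xy.
Qed.

(** The preimage [N] of a small ball around the image of [x] is mapped
bijectively onto that ball. The inverse is continuous because, near the image of
any point [y], equations are solvable with solutions near [y], and solutions in
[W] are unique. Stretching the ball gives the whole Euclidean space. *)
Lemma coordinates_manifold_point k (P : nat -> X) (W : set X) (x : X) :
  open W -> separates k P W ->
  (forall y rho, W y -> 0 < rho -> exists2 delta, 0 < delta &
    forall v : nat -> R, (forall i, (i < k)%N -> `|mdist (P i) y - v i| < delta) ->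
    exists w, [/\ W w, mdist y w < rho
      & forall i, (i < k)%N -> mdist (P i) w = v i]) ->
  W x -> manifold_point x.
Proof.
move=> oW sepW surjW Wx; pose f := distance_map k P.
have finj y z : W y -> W z -> f y = f z -> y = z.
  move=> Wy Wz /rowP fyz; apply: sepW => // i ik.
  by have := fyz (Ordinal ik); rewrite !mxE.
have surj y rho : W y -> 0 < rho -> exists2 delta, 0 < delta &
    forall v, `|f y - v| < delta -> exists w, [/\ W w, mdist y w < rho & f w = v].
  move=> Wy rho0; have [delta delta0 H] := surjW y rho Wy rho0.
  exists delta => // v /(norm_lt_coord _ _ delta0) yv.
  pose v' i := oapp (v 0) 0 (insub i : option 'I_k).
  have [i ik|w [Ww yw wv]] := H v'.
    by have := yv (Ordinal ik); rewrite mxE /v' insubT.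
  exists w; split=> //; apply/rowP => i; rewrite mxE wv//.
  by rewrite /v' valK.
have [d d0 dx] := surj x 1 Wx ltr01.
pose N := W `&` [set w | `|f w - f x| < d].
have Nx : nbhs x N.
  have [e e0 eW] := open_mdist oW Wx.
  apply/nbhs_mdist; exists (Num.min e d); first by rewrite lt_min e0.
  move=> y; rewrite lt_min => /andP[xe xd]; split; first exact: eW.
  by rewrite /= distrC; exact: distance_map_lipschitz.
have /choice[g gE] (u : 'rV[R]_k) :
    exists w : set_type N, f (set_val w) = f x + shrink d u.
  have [|w [Ww _ wE]] := dx (f x + shrink d u).
    by rewrite opprD addrA subrr sub0r normrN; exact: norm_shrink_lt.
  have Nw : N w by split=> //=; rewrite wE addrC addKr; exact: norm_shrink_lt.
  by exists (SigSub (mem_set Nw)).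
have valN (w : set_type N) : N (set_val w) by exact: set_valP.
exists k, N; split=> //.
exists (fun w => stretch d (f (set_val w) - f x)), g; split.
- move=> w; have c1 : {for w, continuous (fun w : set_type N => f (set_val w) - f x)}.
    apply/(@cvgrPdist_lt _ _ _ _ (nbhs_filter w)) => e e0; apply/nbhs_mdist; exists e => // y wy.
    by rewrite opprB addrA subrK; exact: distance_map_lipschitz.
  apply: (continuous_comp c1).
  by apply: stretch_continuous; have [] := valN w.
- move=> u; apply/(@metricType_numDomainType.cvgrPdist_lt _ _ _ _ (nbhs_filter u)) => e e0.
  have [Wu _] := valN (g u).
  have [e' e'0 He] := surj _ e Wu e0.
  have /cvgrPdist_lt /(_ e' e'0) : shrink d y @[y --> u] --> shrink d u.
    exact: shrink_continuous.
  apply: filterS => y uy.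
  have [|w [Ww uw wE]] := He (f (set_val (g y))).
    by rewrite !gE opprD addrACA subrr add0r.
  have [Wy _] := valN (g y).
  rewrite (finj _ _ Ww Wy wE) in uw; exact: uw.
- move=> w; have [Ww wd] := valN w; apply: val_inj.
  have [Ww' _] := valN (g (stretch d (f (set_val w) - f x))).
  apply: finj => //; rewrite gE stretchK//.
  by rewrite addrC subrK.
- by move=> u; rewrite gE addrC addKr shrinkK.
Qed.

End coordinates.

Theorem theorem1p4 (R : realType) (X : metricType R) (gnpcX : gnpc X) :
  exists U : set X, [/\ open U, dense U & forall x : X, U x -> manifold_point x].
Proof.
exists [set x | manifold_point x]; split=> //.
  rewrite openE => x [k [A [/nbhs_interior xA hA]]].
  by apply: filterS xA => y yA; exists k, A.
move=> V [z Vz] oV.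
have [N [r [nb rV]]] := gnpc_normal_ball gnpcX oV Vz.
have [k [P [W [oW [x Wx] Wr sep surj]]]] := exists_coordinates nb.
exists x; split; first by apply: rV; exact: Wr.
exact: (coordinates_manifold_point oW sep surj Wx).
Qed.
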